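(* For all integers $i,j\ge 0$, $U(\kappa^i\xi^j)\in\mathbb{Z}[\xi]$; that is, $U(\kappa^i\xi^j)$ equals, as a formal power series in $q$, a polynomial in $\xi$ with integer coefficients.
   Context: Let $E(q)=\prod_{m\ge1}(1-q^m)$. Define $$\gamma(q)=\frac{E(q)^5E(q^2)^5E(q^6)^5}{E(q^3)^{15}},\qquad \xi=\xi(q)=\frac{E(q^2)^5E(q^6)}{E(q)E(q^3)^5},\qquad \kappa=\kappa(q)=\frac{\gamma(q^2)^2}{\gamma(q)}.$$ $U$ is the operator on power series given by $U\left(\sum_n a_nq^n\right)=\sum_n a_{2n}q^n$. *)

(* Defs.v *)
From mathcomp Require Import all_boot all_order all_algebra.
Set Implicit Arguments. Unset Strict Implicit. Unset Printing Implicit Defensive.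
Import Order.TTheory GRing.Theory Num.Theory.
Local Open Scope ring_scope.

Definition series := nat -> int.

Definition ps_const (c : int) : series := fun n => if n == 0%N then c else 0.
Definition ps_one : series := ps_const 1.

Definition ps_add (f g : series) : series := fun n => f n + g n.
Definition ps_scale (c : int) (f : series) : series := fun n => c * f n.

Definition ps_mul (f g : series) : series :=
  fun n => \sum_(i < n.+1) f i * g (n - i)%N.

Definition ps_pow (f : series) (k : nat) : series := iter k (ps_mul f) ps_one.

(* Multiplicative inverse of a series with constant term 1:
   g 0 = 1,  g n = - \sum_(1 <= i <= n) f i * g (n - i). *)
Fixpoint ps_inv_seq (f : series) (n : nat) : seq int :=
  match n with
  | 0 => [:: 1]
  | n'.+1 =>
      let s := ps_inv_seq f n' in
      rcons s (- \sum_(i < n'.+1) f i.+1 * nth 0 s (n' - i)%N)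
  end.
Definition ps_inv (f : series) : series := fun n => nth 0 (ps_inv_seq f n) n.

(* integer powers (negative powers via ps_inv; meaningful for f 0 = 1) *)
Definition ps_zpow (f : series) (z : int) : series :=
  match z with
  | Posz k => ps_pow f k
  | Negz k => ps_inv (ps_pow f k.+1)
  end.

Definition ps_dil (k : nat) (f : series) : series :=
  fun n => if (k %| n)%N then f (n %/ k)%N else 0.

(* E(q) = prod_{m >= 1} (1 - q^m): the n-th coefficient is the n-th coefficient
   of the finite product over 1 <= m <= n. *)
Definition E_ps : series :=
  fun n => (\prod_(1 <= m < n.+1) (1 - 'X^m : {poly int}))`_n.

Definition Eq (k : nat) : series := ps_dil k E_ps.

Definition gamma_ps : series :=
  ps_mul (ps_mul (ps_mul (ps_pow (Eq 1) 5) (ps_pow (Eq 2) 5)) (ps_pow (Eq 6) 5))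
         (ps_zpow (Eq 3) (-15)).

Definition xi_ps : series :=
  ps_mul (ps_mul (ps_mul (ps_pow (Eq 2) 5) (Eq 6)) (ps_zpow (Eq 1) (-1)))
         (ps_zpow (Eq 3) (-5)).

Definition kappa_ps : series :=
  ps_mul (ps_pow (ps_dil 2 gamma_ps) 2) (ps_zpow gamma_ps (-1)).

Definition U (f : series) : series := fun n => f (2 * n)%N.

Definition ps_poly_eval (p : {poly int}) (f : series) : series :=
  fun n => \sum_(k < size p) p`_k * ps_pow f k n.

(* Main.v *)
Require Import Defs.
From HB Require Import structures.
From mathcomp Require Import all_boot all_order all_algebra.
From mathcomp Require Import boolp zify ring.
Set Implicit Arguments. Unset Strict Implicit. Unset Printing Implicit Defensive.
Import GRing.Theory.
Local Open Scope ring_scope.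

(* Write E_k = E(q^k), y = xi(q^2) and s = q E_2 E_4 E_12^5 / E_6^7, an odd series.
   Multiplying bilateral theta series and separating the parity of the sum of the
   two indices gives f(q,q^5) phi(-q^3) = f(-q^4,-q^8)^2 + q f(-q^2,-q^10)^2 and
   the same formula with q replaced by -q.  By the Jacobi triple product the first
   one is the 2-dissection
     E_3^3 / E_1 = E_4^3 E_6^2 / (E_2^2 E_12) + q E_12^3 / E_4,
   which says kappa = (y + s)^5; the product of both is even, and says
   s^2 = y^2 - y.  Replacing q^2 by q in the latter expresses xi (xi - 1) as an eta
   quotient, so that (xi - 1)(y + s)^3 = s y, and hence
   xi = 5 y - 4 y^2 + s (4 y - 3).  Therefore every kappa^i xi^j lies in
   Z[y] + s Z[y], and U maps p(y) + s r(y) to p(xi). *)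

(** * The ring of formal power series *)

(** A separate name keeps the ring instances off the bare function type, while convertibility with
    [series] makes [ps_mul] the ring product by computation. *)
Definition fps : Type := series.

HB.instance Definition _ := gen_eqMixin fps.
HB.instance Definition _ := gen_choiceMixin fps.

Definition ps_zero : fps := fun=> 0.
Definition ps_opp (f : fps) : fps := fun n => - f n.

Lemma ps_addA : associative (ps_add : fps -> fps -> fps).
Proof. by move=> f g h; apply/funext=> n; rewrite /ps_add addrA. Qed.

Lemma ps_addC : commutative (ps_add : fps -> fps -> fps).
Proof. by move=> f g; apply/funext=> n; rewrite /ps_add addrC. Qed.

Lemma ps_add0 : left_id ps_zero (ps_add : fps -> fps -> fps).
Proof. by move=> f; apply/funext=> n; rewrite /ps_add add0r. Qed.

Lemma ps_addN : left_inverse ps_zero ps_opp (ps_add : fps -> fps -> fps).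
Proof. by move=> f; apply/funext=> n; rewrite /ps_add addNr. Qed.

HB.instance Definition _ :=
  GRing.isZmodule.Build fps ps_addA ps_addC ps_add0 ps_addN.

Definition ptrunc (N : nat) (f : series) : {poly int} := \poly_(i < N) f i.

(** Only coefficients of index at most n matter, so commutativity and associativity are inherited
    from [{poly int}]. *)
Lemma ps_mul_trunc N (f g : series) n : (n < N)%N ->
  ps_mul f g n = (ptrunc N f * ptrunc N g)`_n.
Proof.
move=> ltnN; rewrite coefM; apply: eq_bigr => i _.
by rewrite !coef_poly (leq_ltn_trans (leq_subr _ _) ltnN)
  (leq_ltn_trans (leq_ord i) ltnN).
Qed.

Lemma ps_mulC : commutative (ps_mul : fps -> fps -> fps).
Proof.
by move=> f g; apply/funext=> n; rewrite !(ps_mul_trunc _ _ (ltnSn n)) mulrC.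
Qed.

Lemma ps_mulA : associative (ps_mul : fps -> fps -> fps).
Proof.
have mulr f g h n : ps_mul f (ps_mul g h) n =
    (ptrunc n.+1 f * (ptrunc n.+1 g * ptrunc n.+1 h))`_n.
  rewrite coefM; apply: eq_bigr => i _; rewrite coef_poly ltn_ord.
  by rewrite -(@ps_mul_trunc n.+1) // ltnS leq_subr.
move=> f g h; apply/funext=> n; rewrite [RHS](congr1 (@^~ n) (ps_mulC _ _)).
by rewrite !mulr mulrA mulrC.
Qed.

Lemma ps_mul1 : left_id (ps_one : fps) ps_mul.
Proof.
move=> f; apply/funext=> n; rewrite /ps_mul big_ord_recl subn0 mul1r.
by rewrite big1 ?addr0 // => i _; rewrite mul0r.
Qed.

Lemma ps_mulDl : left_distributive (ps_mul : fps -> fps -> fps) ps_add.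
Proof.
move=> f g h; apply/funext=> n; rewrite /ps_mul /ps_add -big_split.
by apply: eq_bigr => i _; rewrite mulrDl.
Qed.

Lemma ps_one_neq0 : (ps_one : fps) != 0.
Proof. by apply/eqP=> /(congr1 (@^~ 0%N)). Qed.

HB.instance Definition _ := GRing.Zmodule_isComNzRing.Build fps
  ps_mulA ps_mulC ps_mul1 ps_mulDl ps_one_neq0.

Implicit Types f g h e : fps.

Lemma fpsP f g : f =1 g -> f = g. Proof. exact: funext. Qed.
Lemma coefpsD f g n : (f + g) n = f n + g n. Proof. by []. Qed.
Lemma coefpsN f n : (- f) n = - f n. Proof. by []. Qed.
Lemma coefpsM f g n : (f * g) n = \sum_(i < n.+1) f i * g (n - i)%N.
Proof. by []. Qed.
Lemma coefps1 n : (1 : fps) n = (n == 0%N)%:R. Proof. by case: n. Qed.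

Lemma coefps_sum (I : Type) (r : seq I) (P : pred I) (F : I -> fps) n :
  (\sum_(i <- r | P i) F i) n = \sum_(i <- r | P i) F i n.
Proof. by apply: (big_morph (fun f : fps => f n)). Qed.

Lemma ps_powE f k : ps_pow f k = f ^+ k.
Proof. by elim: k => // k IHk; rewrite /ps_pow iterS -/(ps_pow f k) IHk exprS. Qed.

Lemma coef0_mul f g : (f * g) 0%N = f 0%N * g 0%N.
Proof. by rewrite coefpsM big_ord1. Qed.

Lemma coef0_exp f k : f 0%N = 1 -> (f ^+ k) 0%N = 1.
Proof. by move=> f0; elim: k => // k IHk; rewrite exprS coef0_mul f0 IHk. Qed.

Lemma size_ps_inv_seq f n : size (ps_inv_seq f n) = n.+1.
Proof. by elim: n => //= n IHn; rewrite size_rcons IHn. Qed.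

Lemma nth_ps_inv_seq f n k : (k <= n)%N -> nth 0 (ps_inv_seq f n) k = ps_inv f k.
Proof.
elim: n => [|n IHn]; first by rewrite leqn0 => /eqP->.
rewrite leq_eqVlt => /predU1P[->//|]; rewrite ltnS => lekn.
by rewrite /= nth_rcons size_ps_inv_seq ltnS lekn IHn.
Qed.

Lemma ps_mulV f : f 0%N = 1 -> f * (ps_inv f : fps) = 1.
Proof.
move=> f0; apply: fpsP => -[|n]; first by rewrite coef0_mul f0.
rewrite coefpsM big_ord_recl f0 mul1r subn0 {1}/ps_inv /=.
rewrite nth_rcons size_ps_inv_seq ltnn eqxx coefps1 addrC; apply/eqP.
rewrite subr_eq0; apply/eqP/eq_bigr => i _.
by rewrite subSS nth_ps_inv_seq ?leq_subr.
Qed.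

(** Such a series is a unit. Eta quotients are handled below with denominators cleared, and this
    cancellation stands in for division. *)
Lemma lreg_coef0 f : f 0%N = 1 -> GRing.lreg f.
Proof.
move=> f0 g h /(congr1 ( *%R (ps_inv f : fps))).
by rewrite !mulrA ![_ * f]mulrC ps_mulV // !mul1r.
Qed.

Definition ps_poly (p : {poly int}) : fps := fun n => p`_n.

Fact ps_poly_is_zmod_morphism : zmod_morphism ps_poly.
Proof. by move=> p q; apply: fpsP => n; rewrite /ps_poly coefB. Qed.

Fact ps_poly_is_monoid_morphism : monoid_morphism ps_poly.
Proof.
split=> [|p r]; apply: fpsP => n; first by rewrite /ps_poly coef1 coefps1.
by rewrite /ps_poly coefM.
Qed.

HB.instance Definition _ :=
  GRing.isZmodMorphism.Build {poly int} fps ps_poly ps_poly_is_zmod_morphism.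
HB.instance Definition _ :=
  GRing.isMonoidMorphism.Build {poly int} fps ps_poly ps_poly_is_monoid_morphism.

Definition psX : fps := ps_poly 'X.

Lemma coefpsXnM k f n : (psX ^+ k * f) n = if (n < k)%N then 0 else f (n - k)%N.
Proof.
rewrite -rmorphXn /= [LHS](ps_mul_trunc _ _ (ltnSn n)).
have -> : ptrunc n.+1 (ps_poly 'X^k) = \poly_(i < n.+1) ('X^k : {poly int})`_i by [].
have -> : (\poly_(i < n.+1) ('X^k : {poly int})`_i * ptrunc n.+1 f)`_n =
   ('X^k * ptrunc n.+1 f)`_n.
  by rewrite !coefM; apply: eq_bigr => i _; rewrite coef_poly ltn_ord.
by rewrite coefXnM coef_poly ltnS leq_subr.
Qed.

Lemma coefpsXn k n : (psX ^+ k) n = (n == k)%:R.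
Proof. by rewrite -rmorphXn /= /ps_poly coefXn. Qed.

Lemma lreg_psX : GRing.lreg psX.
Proof.
move=> f g eqfg; apply: fpsP => n.
have := congr1 (@^~ n.+1) eqfg.
by rewrite -[psX]expr1 !coefpsXnM /= subn1.
Qed.

(** * Congruence modulo q^N and q-adic convergence *)

Definition eqm N f g := forall n, (n < N)%N -> f n = g n.

Lemma eqmM N f g f' g' : eqm N f f' -> eqm N g g' -> eqm N (f * g) (f' * g').
Proof.
move=> eqf eqg n ltnN; rewrite !coefpsM; apply: eq_bigr => i _.
by rewrite eqf ?eqg // (leq_ltn_trans _ ltnN) ?leq_subr // leq_ord.
Qed.

Lemma eqm_XnM N k f : (N <= k)%N -> eqm N (psX ^+ k * f) 0.
Proof. by move=> leNk n ltnN; rewrite coefpsXnM (leq_trans ltnN). Qed.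

Lemma eqm_mulI N f g h : f 0%N = 1 -> eqm N (f * g) (f * h) -> eqm N g h.
Proof.
move=> f0 eqfgh.
have := @eqmM N (ps_inv f) (f * g) (ps_inv f) (f * h) (fun _ _ => erefl) eqfgh.
by rewrite !mulrA ![_ * f]mulrC ps_mulV // !mul1r.
Qed.

Definition conv (u : nat -> fps) (l : fps) :=
  forall N, exists n0, forall n, (n0 <= n)%N -> eqm N (u n) l.

Lemma conv_unique u l l' : conv u l -> conv u l' -> l = l'.
Proof.
move=> ul ul'; apply: fpsP => n; have [m1 h1] := ul n.+1; have [m2 h2] := ul' n.+1.
by rewrite -(h1 (maxn m1 m2)) ?leq_maxl // (h2 (maxn m1 m2)) ?leq_maxr.
Qed.

Lemma convM u v l l' : conv u l -> conv v l' -> conv (fun n => u n * v n) (l * l').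
Proof.
move=> ul vl' N; have [m1 h1] := ul N; have [m2 h2] := vl' N.
exists (maxn m1 m2) => n; rewrite geq_max => /andP[le1 le2].
by apply: eqmM; [apply: h1 | apply: h2].
Qed.

Lemma conv_sub (s : nat -> nat) u l : (forall n, n <= s n)%N -> conv u l ->
  conv (fun n => u (s n)) l.
Proof.
move=> les ul N; have [m h] := ul N; exists m => n lemn.
by apply: h; apply: leq_trans (les n).
Qed.

Lemma eq_conv u v l : u =1 v -> conv u l -> conv v l.
Proof. by move=> equv ul N; have [m h] := ul N; exists m => n; rewrite -equv; exact: h. Qed.

(** * Partial products of E(q^k) *)

Definition etap (k n : nat) : fps := \prod_(m < n) (1 - psX ^+ (k * m.+1)).

Definition etaq (k : nat) : fps := Eq k.

Lemma etapE k n : (0 < k)%N ->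
  etap k n = ps_poly ((\prod_(1 <= m < n.+1) (1 - 'X^m)) \Po 'X^k).
Proof.
move=> k_gt0; rewrite big_add1 big_mkord rmorph_prod rmorph_prod /=; apply: eq_bigr => m _.
by rewrite rmorphB rmorph1 rmorphXn /= comp_polyX -exprM rmorphB rmorph1 rmorphXn.
Qed.

(** A factor of index d >= N is 1 - q^(k(d+1)) with k(d+1) > N, hence trivial modulo q^(N+1). *)
Lemma eqm_etap k N m n : (0 < k)%N -> (N <= m)%N -> (N <= n)%N ->
  eqm N.+1 (etap k m) (etap k n).
Proof.
move=> k_gt0; have step d : (N <= d)%N -> eqm N.+1 (etap k d.+1) (etap k d).
  move=> leNd i ltiN; rewrite /etap big_ord_recr /= mulrBr mulr1 coefpsD coefpsN.
  rewrite mulrC (@eqm_XnM N.+1) ?subr0 //.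
  by rewrite (leq_trans _ (leq_pmull _ k_gt0)).
have base d : (N <= d)%N -> eqm N.+1 (etap k d) (etap k N).
  move=> leNd; rewrite -(subnKC leNd); elim: (d - N)%N => [|e IHe]; first by rewrite addn0.
  by move=> i ltiN; rewrite addnS step ?leq_addr ?IHe.
by move=> leNm leNn i ltiN; rewrite !base.
Qed.

Lemma conv_etap k : (0 < k)%N -> conv (etap k) (etaq k).
Proof.
move=> k_gt0 N; exists N => n leNn i ltiN.
rewrite etapE // /ps_poly coef_comp_poly_Xn // /etaq /Eq /ps_dil; case: ifP => // _.
set j := (i %/ k)%N; rewrite /E_ps.
have ltjN : (j < N)%N by apply: leq_ltn_trans (leq_div _ _) ltiN.
have E1 d : ((\prod_(1 <= m < d.+1) (1 - 'X^m)) : {poly int})`_j = etap 1 d j.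
  by rewrite etapE // expr1 comp_polyXr.
by rewrite !E1; apply: (@eqm_etap 1 j) => //; apply: leq_trans (ltnW ltjN) leNn.
Qed.

Lemma coef0_etaq k : (0 < k)%N -> etaq k 0%N = 1.
Proof. by move=> k_gt0; rewrite /etaq /Eq /ps_dil dvdn0 div0n /E_ps big_geq // coef1. Qed.

Lemma lreg_etaq k : (0 < k)%N -> GRing.lreg (etaq k).
Proof. by move=> k_gt0; apply/lreg_coef0/coef0_etaq. Qed.

(** * The Jacobi triple product *)

Section QBinomial.
Variables (R : comNzRingType) (Q : R).

(** Gaussian binomial coefficients, given by the q-Pascal rule to avoid division in [R]. *)
Fixpoint qbin (N j : nat) : R :=
  match N, j with
  | _, 0 => 1
  | 0, _.+1 => 0
  | N'.+1, j'.+1 => qbin N' j' + Q ^+ j'.+1 * qbin N' j'.+1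
  end.

Definition qfact n : R := \prod_(m < n) (1 - Q ^+ m.+1).

Lemma qbin0 N : qbin N 0 = 1. Proof. by case: N. Qed.

Lemma qbin_small N j : (N < j)%N -> qbin N j = 0.
Proof.
elim: N j => [|N IHN] [|j] //= ltNj.
by rewrite !IHN ?mulr0 ?addr0 // ltnW.
Qed.

Lemma qbinn N : qbin N N = 1.
Proof. by elim: N => //= N IHN; rewrite IHN qbin_small ?mulr0 ?addr0. Qed.

Lemma qbin_fact j k : qbin (j + k) j * (qfact j * qfact k) = qfact (j + k).
Proof.
have qS n : qfact n.+1 = qfact n * (1 - Q ^+ n.+1) by rewrite /qfact big_ord_recr.
have q0 : qfact 0 = 1 by rewrite /qfact big_ord0.
have [N leN] := ubnP (j + k)%N; elim: N => // N IHN in j k leN *.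
case: j leN => [|j] leN; first by rewrite qbin0 q0 !mul1r.
case: k leN => [|k] leN; first by rewrite addn0 qbinn q0 mulr1 mul1r.
have h1 := IHN j k.+1; have h2 := IHN j.+1 k.
(* Here 1 - Q^(j+k+2) = (1 - Q^(j+1)) + Q^(j+1) (1 - Q^(k+1)), one part for each term of the
   q-Pascal rule. *)
have -> : qfact (j.+1 + k.+1) =
    qfact (j + k.+1) * (1 - Q ^+ j.+1) + Q ^+ j.+1 * (1 - Q ^+ k.+1) * qfact (j.+1 + k).
  by rewrite addSn qS addSnnS -addSn exprD; ring.
rewrite -h1 -?h2; [|lia|lia]; clear h1 h2.
by rewrite !qS [qbin (j.+1 + k.+1) _]/= -addSnnS; ring.
Qed.

(** Induction on N: after the factor k = 0 is split off, the others form the same product with y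
    replaced by y Q. *)
Lemma q_binomial N (x y : R) :
  \prod_(k < N) (x + y * Q ^+ k) =
  \sum_(j < N.+1) Q ^+ 'C(j, 2) * qbin N j * y ^+ j * x ^+ (N - j).
Proof.
elim: N y => [|N IHN] y; first by rewrite big_ord0 big_ord1 /=; ring.
rewrite big_ord_recl expr0 mulr1.
have -> : \prod_(i < N) (x + y * Q ^+ lift ord0 i) =
    \prod_(i < N) (x + (y * Q) * Q ^+ i).
  by apply: eq_bigr => i _; rewrite lift0 exprS mulrA.
rewrite IHN mulrDl !mulr_sumr.
pose F j := Q ^+ 'C(j, 2) * qbin N j * (y * Q) ^+ j.
rewrite [RHS]big_ord_recl bin0n [qbin _ _]/=.
have -> : \sum_(i < N.+1) x * (Q ^+ 'C(i, 2) * qbin N i * (y * Q) ^+ i * x ^+ (N - i))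
    = x ^+ N.+1 + \sum_(i < N.+1) F i.+1 * x ^+ (N - i).
  rewrite big_ord_recl [in RHS]big_ord_recr /= /F (qbin_small (ltnSn N)) mulr0 !mul0r addr0.
  rewrite bin0n qbin0 subn0 exprS; congr (_ + _); first by ring.
  by apply: eq_bigr => i _; rewrite /bump add1n mulrCA -exprS subnSK.
rewrite -addrA -big_split /=; congr (_ + _); first by rewrite subn0; ring.
apply: eq_bigr => i _; rewrite /bump add1n subSS /F binS bin1 exprD.
by rewrite !exprMn !exprS add0n; ring.
Qed.

End QBinomial.

Lemma etap_qfact b n : etap b n = qfact (psX ^+ b) n.
Proof. by apply: eq_bigr => m _; rewrite exprM. Qed.

(* [texp c d i = (c + d) i (i - 1) / 2 + c i], split on the sign of [i] so as to
   stay in [nat]. *)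
Definition texp (c d : nat) (i : int) : nat :=
  match i with
  | Posz k => (c + d) * 'C(k, 2) + c * k
  | Negz k => (c + d) * 'C(k.+1, 2) + d * k.+1
  end.

Lemma bin2Z k : ('C(k, 2))%:Z *+ 2 = k%:Z * (k%:Z - 1).
Proof.
have := bin2 k; have := odd_double_half (k * k.-1); rewrite oddM.
case: k => [|k] //=; rewrite andNb /= => h1 h2; nia.
Qed.

(** One formula for both signs of i, doubled to avoid halves, so that exponent identities become
    polynomial ones. *)
Lemma texpE c d i :
  (texp c d i)%:Z *+ 2 = (c + d)%:Z * (i * (i - 1)) + c%:Z * i *+ 2.
Proof.
case: i => k; rewrite ?NegzE /texp !(PoszD, PoszM).
  have -> : ((c%:Z + d%:Z) * 'C(k, 2)%:Z + c%:Z * k%:Z) *+ 2 =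
    (c%:Z + d%:Z) * ('C(k, 2)%:Z *+ 2) + c%:Z * k%:Z *+ 2 by ring.
  by rewrite bin2Z.
have -> : ((c%:Z + d%:Z) * 'C(k.+1, 2)%:Z + d%:Z * k.+1%:Z) *+ 2 =
  (c%:Z + d%:Z) * ('C(k.+1, 2)%:Z *+ 2) + d%:Z * k.+1%:Z *+ 2 by ring.
by rewrite bin2Z; ring.
Qed.

Lemma texp_ge c d i : (0 < c)%N -> (0 < d)%N -> (`|i| <= texp c d i)%N.
Proof.
move=> c0 d0; case: i => k; rewrite /texp ?absz_nat ?NegzE ?abszN ?absz_nat;
  apply: leq_trans (leq_addl _ _); exact: leq_pmull.
Qed.

Definition irange (n : nat) : seq int := [seq k%:Z - n%:Z | k <- iota 0 (n.*2).+1].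

Lemma mem_irange n i : (i \in irange n) = (`|i| <= n)%N.
Proof.
apply/mapP/idP => [[k + ->]|lein]; first by rewrite mem_iota; lia.
by exists (absz (i + n%:Z)); rewrite ?mem_iota; lia.
Qed.

Lemma irange_uniq n : uniq (irange n).
Proof. by rewrite map_inj_uniq ?iota_uniq // => k l; lia. Qed.

(** When e * e = 1, e^|i| is e^i, and the sum over all i is Ramanujan's f(e q^c, e q^d). *)
Definition theta_term c d (e : fps) (i : int) : fps := psX ^+ texp c d i * e ^+ `|i|%N.

Definition theta_part c d e n : fps := \sum_(i <- irange n) theta_term c d e i.

(** For positive c and d the exponent is at least |i| ([texp_ge]), so terms with |i| > n do not
    reach q^n and each coefficient is exact. *)
Definition theta c d e : fps := fun n => theta_part c d e n n.

Lemma big_support (I : eqType) (V : nmodType) (r s : seq I) (F : I -> V) :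
    uniq r -> uniq s -> (forall x, F x != 0 -> (x \in r) = (x \in s)) ->
  \sum_(x <- r) F x = \sum_(x <- s) F x.
Proof.
move=> ur us rs.
have nz t : \sum_(x <- t) F x = \sum_(x <- t | F x != 0) F x.
  by rewrite [RHS]big_mkcond; apply: eq_bigr => x _; case: eqP.
rewrite nz [RHS]nz -big_filter -[RHS]big_filter; apply: perm_big.
apply: uniq_perm; rewrite ?filter_uniq //.
by move=> x; rewrite !mem_filter; case: (eqVneq (F x) 0) => //= /rs.
Qed.

Lemma coef_theta_term c d e i n : (n < texp c d i)%N -> theta_term c d e i n = 0.
Proof. by move=> lt; rewrite /theta_term coefpsXnM lt. Qed.

Lemma eqm_theta c d e N n : (0 < c)%N -> (0 < d)%N -> (N <= n)%N ->
  eqm N (theta_part c d e n) (theta c d e).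
Proof.
move=> c0 d0 leNn i ltiN; rewrite /theta /theta_part !coefps_sum.
apply: big_support; rewrite ?irange_uniq // => x; rewrite !mem_irange => xn0.
have : (`|x| <= i)%N.
  apply: leq_trans (texp_ge x c0 d0) _; rewrite leqNgt.
  by apply: contra xn0 => /coef_theta_term->.
by lia.
Qed.

Definition jprod c d (e : fps) n : fps :=
  \prod_(k < n) ((1 + e * psX ^+ (c + (c + d) * k)) * (1 + e * psX ^+ (d + (c + d) * k))).

(* The q-binomial theorem with [x = q^(b n)], [y = e q^c] and base [q^b], after
   cancelling the monomial [e^n q^M]. *)
Lemma finite_jtp c d (e : fps) n : e * e = 1 ->
  jprod c d e n =
  \sum_(j < n.*2.+1) qbin (psX ^+ (c + d)) n.*2 j * theta_term c d e (j%:Z - n%:Z).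
Proof.
move=> ee; set b := (c + d)%N; have reg_e : GRing.lreg e.
  by move=> f g /(congr1 ( *%R e)); rewrite !mulrA ee !mul1r.
(* M is the sum of c + b i + b n over i < n, the exponent extracted from the 2 n factors below. *)
pose M := (b * n * n + c * n + b * 'C(n, 2))%N.
apply: (lregM (lregX (n := n) reg_e) (lregX (n := M) lreg_psX)).
have <- : \prod_(k < n.*2) (psX ^+ (b * n) + e * psX ^+ c * psX ^+ b ^+ k) =
    e ^+ n * psX ^+ M * jprod c d e n.
  (* The lower n factors, read backwards, yield e q^(c + b (n - i - 1)) (1 + e q^(d + b i)), and the
     upper ones q^(b n) (1 + e q^(c + b i)). *)
  rewrite -addnn big_split_ord /= (reindex_inj rev_ord_inj) /= -big_split /=.
  have -> : e ^+ n * psX ^+ M =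
      \prod_(i < n) (e * psX ^+ (c + b * (n - i.+1) + b * n)).
    rewrite big_split prodr_const card_ord prodrXr; congr (_ * psX ^+ _).
    rewrite (reindex_inj rev_ord_inj) /=.
    rewrite (eq_bigr (fun i : 'I_n => c + b * i + b * n)%N) => [|i _]; last first.
      by rewrite subnSK // subKn // ltnW.
    rewrite !big_split !sum_nat_const card_ord -big_distrr /=.
    rewrite -(big_mkord xpredT id) bin2_sum /M; lia.
  rewrite -big_split; apply: eq_bigr => i _ /=.
  have -> : psX ^+ (b * n) + e * psX ^+ c * psX ^+ b ^+ (n - i.+1) =
      e * psX ^+ (c + b * (n - i.+1)) * (1 + e * psX ^+ (d + b * i)).
    have -> : (b * n = c + b * (n - i.+1) + (d + b * i))%N.
      have := ltn_ord i; rewrite /b; nia.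
    by rewrite -exprM !exprD; ring: ee.
  have -> : psX ^+ (b * n) + e * psX ^+ c * psX ^+ b ^+ (n + i) =
      psX ^+ (b * n) * (1 + e * psX ^+ (c + b * i)).
    by rewrite -exprM mulnDr !exprD; ring.
  by rewrite [in RHS]exprD; ring.
rewrite q_binomial mulr_sumr; apply: eq_bigr => j _.
have sgn : e ^+ j = e ^+ n * e ^+ `|(j : nat)%:Z - n%:Z|%N.
  have ek k : e ^+ k * e ^+ k = 1 by rewrite -exprMn ee expr1n.
  have [lenj|ltjn] := leqP n j.
    by rewrite -exprD; congr (_ ^+ _); lia.
  have -> : `|(j : nat)%:Z - n%:Z|%N = (n - j)%N by lia.
  by rewrite -[in e ^+ n](subnKC (ltnW ltjn)) exprD -mulrA ek mulr1.
have expo : (b * 'C(j, 2) + c * j + b * n * (n.*2 - j) =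
    M + texp c d ((j : nat)%:Z - n%:Z))%N.
  have := texpE c d ((j : nat)%:Z - n%:Z).
  have := congr1 ( *%R b%:Z) (bin2Z j); have := congr1 ( *%R b%:Z) (bin2Z n).
  move: (texp c d _) (leq_ord j) => t; rewrite /M /b.
  move: ('C(j, 2)) ('C(n, 2)) (nat_of_ord j) => Cj Cn i lei.
  have [k [-> n2]] : exists k, (n.*2 - i)%N = k /\ n.*2 = (i + k)%N.
    by exists (n.*2 - i)%N; lia.
  have -> : i = (n + n - k)%N by lia.
  have : (k <= n + n)%N by lia.
  clear; nia.
rewrite /theta_term -!exprM exprMn -!exprM sgn.
set Qb := qbin _ _ _; set s := e ^+ `|_|%N.
have : psX ^+ (b * 'C(j, 2)) * psX ^+ (c * j) * psX ^+ (b * n * (n.*2 - j)) =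
    psX ^+ M * psX ^+ texp c d ((j : nat)%:Z - n%:Z) by rewrite -!exprD expo.
move: (psX ^+ texp c d _) => w H; transitivity (Qb * e ^+ n * s * (psX ^+ M * w)).
  by rewrite -H; ring.
ring.
Qed.

Lemma coef0_etap b n : (0 < b)%N -> etap b n 0%N = 1.
Proof. by move=> b0; rewrite (@eqm_etap b 0 n 0) // /etap big_ord0. Qed.

(** By [qbin_fact] the coefficient is a quotient of products [etap b m] with m = 2n over those with
    m = j and m = 2n - j, and all of these agree with [etap b n] modulo q^N. *)
Lemma eqm_etap_qbin b N n j : (0 < b)%N -> (N <= n)%N -> (j <= n.*2)%N ->
    (N <= j)%N -> (N <= n.*2 - j)%N ->
  eqm N (etap b n * qbin (psX ^+ b) n.*2 j) 1.
Proof.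
move=> b0 leNn lej leNj leN2.
have eqP m m' : (N <= m)%N -> (N <= m')%N -> eqm N (etap b m) (etap b m').
  by move=> lem lem' i lti; apply: (@eqm_etap b N) => //; apply: leqW.
apply: (eqm_mulI (coef0_etap n b0)); set Qb := qbin _ _ _ => i lti.
have -> : (etap b n * 1) i = etap b n.*2 i.
  by rewrite mulr1; apply: eqP lti; rewrite // -addnn (leq_trans leNn) ?leq_addr.
have -> : etap b n.*2 = etap b j * (etap b (n.*2 - j) * Qb).
  rewrite !etap_qfact -{1}(subnKC lej) -qbin_fact subnKC // -/Qb.
  by rewrite mulrC mulrA.
by do 2![apply: eqmM lti => // {}i lti; first exact: eqP].
Qed.

(** The Jacobi triple product, as the limit of [finite_jtp]. *)
Lemma conv_jtp c d e : (0 < c)%N -> (0 < d)%N -> e * e = 1 ->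
  conv (fun n => etap (c + d) n * jprod c d e n) (theta c d e).
Proof.
(* Terms of exponent at least N vanish modulo q^N; the others have |j - n| < N, and n >= 2 N then
   gives j >= N and 2 n - j >= N for [eqm_etap_qbin]. *)
move=> c0 d0 ee N; exists N.*2 => n le2n i ltiN.
have leNn : (N <= n)%N by apply: leq_trans le2n; rewrite -addnn leq_addr.
rewrite -(eqm_theta (n := n) e c0 d0 leNn ltiN) finite_jtp // mulr_sumr.
rewrite /theta_part big_map -[iota _ _]/(index_iota 0 (n.*2).+1) big_mkord.
rewrite !coefps_sum; apply: eq_bigr => j _.
have [geN|ltN] := leqP N (texp c d ((j : nat)%:Z - n%:Z)).
  by rewrite mulrA mulrC -[RHS]mulr1 /theta_term -!mulrA !(eqm_XnM _ geN ltiN).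
have := leq_ltn_trans (texp_ge ((j : nat)%:Z - n%:Z) c0 d0) ltN => ltj.
rewrite mulrA -[RHS](congr1 (fun f : fps => f i) (mul1r _)).
apply: eqmM ltiN => //; apply: eqm_etap_qbin; rewrite ?addn_gt0 ?c0 //.
- by have := ltn_ord j; lia.
- lia.
- lia.
Qed.

Lemma mulN1N1 : (-1) * (-1) = 1 :> fps. Proof. by rewrite mulrNN mulr1. Qed.

Lemma jprod_conj c d e n : e * e = 1 ->
  jprod c d e n * jprod c d (- e) n = jprod (c * 2) (d * 2) (-1) n.
Proof.
move=> ee; rewrite -big_split; apply: eq_bigr => k _ /=.
rewrite (_ : c * 2 + _ = (c + (c + d) * k) * 2)%N; last by lia.
rewrite (_ : d * 2 + _ = (d + (c + d) * k) * 2)%N; last by lia.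
by rewrite !exprM; ring: ee.
Qed.

(** From (1 + z)(1 - z) = 1 - z^2 in the triple products. This is f(a, b) f(-a, -b) = f(-a^2, -b^2)
    phi(-a b) for a = e q^c, b = e q^d, with phi(-q^m) = E_m^2 / E_(2m). *)
Lemma theta_conj c d e : (0 < c)%N -> (0 < d)%N -> e * e = 1 ->
  theta c d e * theta c d (- e) * etaq ((c + d) * 2) =
  theta (c * 2) (d * 2) (-1) * (etaq (c + d) * etaq (c + d)).
Proof.
move=> c0 d0 ee; have b0 : (0 < c + d)%N by rewrite addn_gt0 c0.
have ee' : - e * - e = 1 by rewrite mulrNN.
have cb := conv_etap b0.
apply: (@conv_unique _ _ _ (convM (convM (conv_jtp c0 d0 ee) (conv_jtp c0 d0 ee'))
  (@conv_etap ((c + d) * 2) _))); first by rewrite muln_gt0 b0.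
apply: eq_conv (convM (@conv_jtp (c * 2) (d * 2) _ _ _ mulN1N1) (convM cb cb)).
- by move=> n; rewrite -mulnDl -(jprod_conj _ _ _ ee); ring.
- by rewrite muln_gt0 c0.
- by rewrite muln_gt0 d0.
Qed.

(** * Theta series as eta quotients, by sorting factors into residue classes *)

Lemma etap_block k r n :
  etap k (r * n) = \prod_(m < n) \prod_(i < r) (1 - psX ^+ (k * (r * m + i).+1)).
Proof.
elim: n => [|n IHn]; first by rewrite muln0 /etap !big_ord0.
by rewrite mulnS addnC /etap big_split_ord big_ord_recr /= -IHn.
Qed.

Lemma jprodN1 c d n : jprod c d (-1) n =
  \prod_(k < n) ((1 - psX ^+ (c + (c + d) * k)) * (1 - psX ^+ (d + (c + d) * k))).
Proof. by apply: eq_bigr => k _; rewrite !mulN1r. Qed.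

Lemma theta_diag m : (0 < m)%N ->
  theta m m (-1) * etaq (m * 2) = etaq m * etaq m.
Proof.
move=> m0; have m20 : (0 < m * 2)%N by rewrite muln_gt0 m0.
apply: (conv_unique (convM (conv_jtp m0 m0 mulN1N1) (conv_etap m20))).
have cm : conv (fun n => etap m (2 * n)) (etaq m).
  by apply: conv_sub (conv_etap m0) => n; lia.
apply: eq_conv (convM cm cm) => n.
rewrite addnn -muln2 etap_block jprodN1 /etap -!big_split; apply: eq_bigr => k _ /=.
rewrite !big_ord_recr big_ord0 /= mul1r.
rewrite (_ : m * (2 * k + 0).+1 = m + (m + m) * k)%N; last by lia.
rewrite (_ : m * (2 * k + 1).+1 = m * 2 * k.+1)%N; last by lia.
by ring.
Qed.

(** Euler's pentagonal number theorem in q^m: the residues 1, 2 and 0 modulo 3 exhaust the factors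
    of E_m. *)
Lemma theta_pentagonal m : (0 < m)%N -> theta (m * 2) m (-1) = etaq m.
Proof.
move=> m0; have m20 : (0 < m * 2)%N by rewrite muln_gt0 m0.
apply: (conv_unique (conv_jtp m20 m0 mulN1N1)).
have cm : conv (fun n => etap m (3 * n)) (etaq m).
  by apply: conv_sub (conv_etap m0) => n; lia.
apply: eq_conv cm => n.
rewrite etap_block jprodN1 /etap -!big_split; apply: eq_bigr => k _ /=.
rewrite !big_ord_recr big_ord0 /= mul1r.
rewrite (_ : m * (3 * k + 0).+1 = m + (m * 2 + m) * k)%N; last by lia.
rewrite (_ : m * (3 * k + 1).+1 = m * 2 + (m * 2 + m) * k)%N; last by lia.
rewrite (_ : m * (3 * k + 2).+1 = (m * 2 + m) * k.+1)%N; last by lia.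
by ring.
Qed.

(** By inclusion-exclusion the indices prime to 6 contribute E_m E_(6m) / (E_(2m) E_(3m)); the
    triple product supplies one more E_(6m). *)
Lemma theta_5_1 m : (0 < m)%N ->
  theta (m * 5) m (-1) * (etaq (m * 2) * etaq (m * 3)) =
  etaq m * (etaq (m * 6) * etaq (m * 6)).
Proof.
move=> m0; have m50 : (0 < m * 5)%N by rewrite muln_gt0 m0.
have cm a r : (0 < a)%N -> (0 < r)%N -> conv (fun n => etap (m * a) (r * n)) (etaq (m * a)).
  move=> a0 r0; apply: (@conv_sub (fun n => r * n)%N) => [n|]; first exact: leq_pmull.
  by apply: conv_etap; rewrite muln_gt0 m0.
apply: (conv_unique (convM (conv_jtp m50 m0 mulN1N1) (convM (cm 2 3 _ _) (cm 3 2 _ _)))) => //.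
have c1 := cm 1%N 6 isT isT; have c6 := cm 6 1%N isT isT; rewrite muln1 in c1.
apply: eq_conv (convM c1 (convM c6 c6)) => n.
rewrite (_ : m * 5 + m = m * 6)%N; last by lia.
rewrite mul1n !etap_block jprodN1 /etap -!big_split; apply: eq_bigr => k _ /=.
rewrite !big_ord_recr !big_ord0 /= !mul1r.
(* Once each exponent is located in the k-th block of six, both sides are monomials in [F 1], ...,
   [F 6]. *)
pose F j : fps := 1 - psX ^+ (m * (6 * k + j)).
have FE j x : x = (m * (6 * k + j))%N -> 1 - psX ^+ x = F j by move=> ->.
rewrite !(FE 1%N (m * (6 * k + 0).+1)%N) ?(FE 2 (m * (6 * k + 1).+1)%N); try lia.
rewrite !(FE 3 (m * (6 * k + 2).+1)%N) ?(FE 4 (m * (6 * k + 3).+1)%N); try lia.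
rewrite !(FE 5 (m * (6 * k + 4).+1)%N) ?(FE 6 (m * (6 * k + 5).+1)%N); try lia.
rewrite !(FE 2 (m * 2 * (3 * k + 0).+1)%N) ?(FE 4 (m * 2 * (3 * k + 1).+1)%N); try lia.
rewrite !(FE 6 (m * 2 * (3 * k + 2).+1)%N) ?(FE 3 (m * 3 * (2 * k + 0).+1)%N); try lia.
rewrite !(FE 6 (m * 3 * (2 * k + 1).+1)%N) ?(FE 6 (m * 6 * k.+1)%N); try lia.
rewrite (FE 5 (m * 5 + (m * 5 + m) * k)%N) ?(FE 1%N (m + (m * 5 + m) * k)%N); try lia.
by ring.
Qed.

(** * A product formula of Schroeter type *)

Lemma expr_odd e k : e * e = 1 -> e ^+ k = e ^+ odd k.
Proof.
by move=> ee; rewrite -{1}[k]odd_double_half exprD -mul2n exprM expr2 ee expr1n mulr1.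
Qed.

Lemma int_pair_parity (i j : int) :
  (exists u v, i = u + v /\ j = u - v) \/ (exists u v, i = - u - v - 1 /\ j = v - u).
Proof.
have [/eqP par|/eqP par] := boolP (((i + j) %% 2)%Z == 0).
  by left; exists ((i + j) %/ 2)%Z, ((i - j) %/ 2)%Z; lia.
by right; exists ((- i - 1 - j) %/ 2)%Z, ((j - i - 1) %/ 2)%Z; lia.
Qed.

(* The parity of [i + j] separates the two terms: [i = u + v], [j = u - v] for
   even sum and [i = - u - v - 1], [j = v - u] for odd sum. *)
Lemma schroeter e : e * e = 1 ->
  theta 5 1 e * theta 3 3 (- e) =
  theta 8 4 (-1) * theta 8 4 (-1) +
  e * psX * (theta 10 2 (-1) * theta 10 2 (-1)).
Proof.
move=> ee.
pose G (p : int * int) := theta_term 5 1 e p.1 * theta_term 3 3 (- e) p.2.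
pose h1 (p : int * int) : int * int := (p.1 + p.2, p.1 - p.2).
pose h2 (p : int * int) : int * int := (- p.1 - p.2 - 1, p.2 - p.1).
pose box n := [seq (i, j) | i <- irange n, j <- irange n].
have prod_part c d c' d' e1 e2 n : theta_part c d e1 n * theta_part c' d' e2 n =
    \sum_(p <- box n) theta_term c d e1 p.1 * theta_term c' d' e2 p.2.
  rewrite /box big_allpairs_dep mulr_suml; apply: eq_bigr => i _.
  by rewrite mulr_sumr.
(* The exponent 3 i^2 + 2 i + 3 j^2 becomes (6 u^2 + 2 u) + (6 v^2 + 2 v) under [h1], and (6 u^2 + 4
   u) + (6 v^2 + 4 v) + 1 under [h2], whence the extra factor [psX] there. *)
have G1 p : theta_term 8 4 (-1) p.1 * theta_term 8 4 (-1) p.2 = G (h1 p).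
  case: p => u v; rewrite /G /h1 /theta_term /= mulrACA -exprD [RHS]mulrACA -[in RHS]exprD.
  have -> : (texp 8 4 u + texp 8 4 v = texp 5 1 (u + v)%R + texp 3 3 (u - v)%R)%N.
    have := texpE 8 4 u; have := texpE 8 4 v.
    by have := texpE 5 1 (u + v); have := texpE 3 3 (u - v); nia.
  congr (_ * _); rewrite (exprNn e) [RHS]mulrCA -!exprD (expr_odd _ ee) (expr_odd _ mulN1N1).
  have [-> ->] : odd (`|u + v| + `|u - v|) = false /\
      odd (`|u| + `|v|) = odd `|u - v| by lia.
  by rewrite mulr1 -expr_odd // mulN1N1.
have G2 p : e * psX * (theta_term 10 2 (-1) p.1 * theta_term 10 2 (-1) p.2) = G (h2 p).
  case: p => u v; rewrite /G /h2 /theta_term /= [X in _ * X]mulrACA -exprD.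
  rewrite [e * psX]mulrC mulrACA -exprS [RHS]mulrACA -[in RHS]exprD.
  have -> : ((texp 10 2 u + texp 10 2 v).+1 =
      texp 5 1 (- u - v - 1)%R + texp 3 3 (v - u)%R)%N.
    have := texpE 10 2 u; have := texpE 10 2 v.
    by have := texpE 5 1 (- u - v - 1); have := texpE 3 3 (v - u); nia.
  congr (_ * _); rewrite (exprNn e) [RHS]mulrCA -!exprD (expr_odd _ ee) (expr_odd _ mulN1N1).
  have [-> ->] : odd (`|(- u - v - 1)%R| + `|(v - u)%R|) = true /\
      odd (`|u| + `|v|) = odd `|(v - u)%R| by lia.
  by rewrite expr1 mulrC -expr_odd // mulN1N1.
apply: fpsP => n; have [M ltnM] : exists M, (n < M)%N by exists n.+1.
have th c d e1 : (0 < c)%N -> (0 < d)%N -> eqm n.+1 (theta c d e1) (theta_part c d e1 M).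
  by move=> c0 d0 i lti; rewrite (eqm_theta _ c0 d0 ltnM).
have th2 (c d c' d' : nat) e1 e2 : (0 < c)%N -> (0 < d)%N -> (0 < c')%N -> (0 < d')%N ->
    eqm n.+1 (theta c d e1 * theta c' d' e2) (theta_part c d e1 M * theta_part c' d' e2 M).
  by move=> *; apply: eqmM; apply: th.
rewrite (th2 5%N 1%N 3%N 3%N) // coefpsD (th2 8%N 4%N 8%N 4%N) //.
rewrite (eqmM (fun _ _ => erefl _) (th2 10%N 2%N 10%N 2%N (-1) (-1) isT isT isT isT)) //.
rewrite !prod_part mulr_sumr.
rewrite (eq_bigr _ (fun p _ => G1 p)) (eq_bigr _ (fun p _ => G2 p)).
rewrite -coefpsD -(big_map h1 xpredT G) -(big_map h2 xpredT G) -big_cat.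
rewrite !coefps_sum.
have ubox : uniq (box M).
  by apply: allpairs_uniq; rewrite ?irange_uniq // => -[? ?] [? ?].
have mbox i j : ((i, j) \in box M) = (`|i| <= M)%N && (`|j| <= M)%N.
  rewrite -!mem_irange; apply/allpairsP/andP => [[[a b] [/= ? ? [-> ->]]]|[? ?]] //.
  by exists (i, j).
(* The index sets differ, but a nonzero n-th coefficient forces |i| + |j| <= n < M, which puts both
   (i, j) and its preimage (u, v) in [box M]. *)
apply: big_support => //.
  rewrite cat_uniq !map_inj_uniq ?ubox ?andbT //.
  - apply/hasPn => _ /mapP [[u v] _ ->]; apply/mapP => -[[u' v'] _ []].
    by rewrite /h1 /h2 /=; lia.
  - by move=> [a b] [a' b'] /= [] *; congr (_, _); lia.
  - by move=> [a b] [a' b'] /= [] *; congr (_, _); lia.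
move=> [i j] nz.
have le_n : (texp 5 1 i + texp 3 3 j <= n)%N.
  rewrite leqNgt; apply: contra nz => lt; apply/eqP.
  by rewrite /G /theta_term mulrACA -exprD coefpsXnM lt.
have := texp_ge i (isT : 0 < 5)%N (isT : 0 < 1)%N.
have := texp_ge j (isT : 0 < 3)%N (isT : 0 < 3)%N.
rewrite mbox mem_cat => lej lei.
have -> : (`|i| <= M)%N && (`|j| <= M)%N by lia.
apply/esym/orP.
have [[u [v [Ei Ej]]]|[u [v [Ei Ej]]]] := int_pair_parity i j; subst i j.
  by left; apply/mapP; exists (u, v); rewrite ?mbox //; lia.
by right; apply/mapP; exists (u, v); rewrite ?mbox //; lia.
Qed.

(** * Eta quotients *)

Section EtaAlgebra.
Variable R : comNzRingType.

(* [tp], [tm] stand for f(q, q^5), f(-q, -q^5); [pp], [pm] for phi(q^3), phi(-q^3);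
   [b] for f(-q^2, -q^10) and [d] for phi(-q^6), in Ramanujan's notation. *)
Lemma dissection_identities (q e1 e2 e3 e4 e6 e12 tp tm pp pm b d : R) :
    GRing.lreg e6 -> GRing.lreg e12 ->
    tp * pm = e4 * e4 + q * (b * b) -> tm * pp = e4 * e4 - q * (b * b) ->
    tm * (e2 * e3) = e1 * (e6 * e6) -> b * (e4 * e6) = e2 * (e12 * e12) ->
    tp * tm * e12 = b * (e6 * e6) -> pm * e6 = e3 * e3 ->
    d * e12 = e6 * e6 -> pp * pm * e12 = d * (e6 * e6) ->
  e3 ^+ 3 * e2 ^+ 2 * e12 * e4 = e1 * (e4 ^+ 4 * e6 ^+ 2 + q * e2 ^+ 2 * e12 ^+ 4) /\
  (e4 ^+ 8 * e6 ^+ 4 - q ^+ 2 * e2 ^+ 4 * e12 ^+ 8) * e12 = e2 * e4 ^+ 3 * e6 ^+ 9.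
Proof.
move=> reg6 reg12 Sp Sm Etm Eb Econj Epm Ed Econj2; split.
  (* The eta quotient of f(q, q^5), found by dividing f(q, q^5) f(-q, -q^5) by its second factor. *)
  have Etp : tp * (e1 * e4 * e6) = e2 ^+ 2 * e3 * e12.
    apply: (lregM reg12 (lregM reg6 reg6)).
    transitivity ((tp * tm * e12) * (e2 * e3) * (e4 * e6)).
      transitivity (tp * e12 * (e4 * e6) * (e1 * (e6 * e6))); first by ring.
      by rewrite -Etm; ring.
    rewrite Econj; transitivity (b * (e4 * e6) * (e6 * e6 * (e2 * e3))); first by ring.
    by rewrite Eb; ring.
  transitivity (e2 ^+ 2 * e3 * e12 * (e3 * e3) * e4); first by ring.
  rewrite -Etp -Epm; transitivity (tp * pm * (e1 * e4 ^+ 2 * e6 ^+ 2)); first by ring.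
  rewrite Sp; transitivity (e1 * (e4 ^+ 4 * e6 ^+ 2 + q * (b * (e4 * e6)) ^+ 2)); first by ring.
  by rewrite Eb; ring.
apply: (lregM reg12 reg12).
(* A difference of squares: up to eta factors this is the product of [Sp] and [Sm]. *)
transitivity (e4 ^+ 4 * e6 ^+ 4 * e12 ^+ 3 *
  (e4 * e4 + q * (b * b)) * (e4 * e4 - q * (b * b))).
  transitivity ((e4 ^+ 8 * e6 ^+ 4 - q ^+ 2 * (e2 * (e12 * e12)) ^+ 4) * e12 ^+ 3).
    by ring.
  by rewrite -Eb; ring.
rewrite -Sp -Sm; transitivity (e4 ^+ 4 * e6 ^+ 4 * (tp * tm * e12) * (pp * pm * e12) * e12).
  by ring.
rewrite Econj Econj2; transitivity (e4 ^+ 3 * e6 ^+ 7 * (b * (e4 * e6)) * (d * e12)).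
  by ring.
by rewrite Eb Ed; ring.
Qed.

(* [x], [y] and [s] stand for [xi(q)], [xi(q^2)] and [s_ps], and [ek] for [E(q^k)]. *)
Variables q e1 e2 e3 e4 e6 e12 x y s : R.
Hypotheses (reg1 : GRing.lreg e1) (reg2 : GRing.lreg e2) (reg3 : GRing.lreg e3).
Hypotheses (reg6 : GRing.lreg e6) (regy : GRing.lreg y).
Hypothesis dissection :
  e3 ^+ 3 * e2 ^+ 2 * e12 * e4 = e1 * (e4 ^+ 4 * e6 ^+ 2 + q * e2 ^+ 2 * e12 ^+ 4).
Hypothesis Ey : y * (e2 * e6 ^+ 5) = e4 ^+ 5 * e12.
Hypothesis Ex : x * (e1 * e3 ^+ 5) = e2 ^+ 5 * e6.
Hypothesis Es : s * e6 ^+ 7 = q * e2 * e4 * e12 ^+ 5.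

(** Over a common denominator, x^2 - x is a difference of two eta products; the hypothesis, the
    second of [dissection_identities] with q^2 replaced by q, collapses it to one. *)
Lemma level6_relation :
    (e2 ^+ 8 * e3 ^+ 4 - q * e1 ^+ 4 * e6 ^+ 8) * e6 = e1 * e2 ^+ 3 * e3 ^+ 9 ->
  x * (x - 1) * e3 ^+ 14 = q * (e1 * e2 * e6 ^+ 5) ^+ 2.
Proof.
move=> rel; apply: (lregX (n := 2) reg1).
transitivity ((x * (e1 * e3 ^+ 5)) ^+ 2 * e3 ^+ 4 - x * (e1 * e3 ^+ 5) * e1 * e3 ^+ 9).
  by ring.
rewrite Ex; transitivity (e2 ^+ 10 * e6 ^+ 2 * e3 ^+ 4 -
  e2 ^+ 2 * e6 * (e1 * e2 ^+ 3 * e3 ^+ 9)); first by ring.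
by rewrite -rel; ring.
Qed.

(** Multiplying the 2-dissection of E_3^3 / E_1 by E_2 E_4^2 E_12^2 / E_6^7 turns its two terms into
    y and s. *)
Lemma y_add_s : (y + s) * (e1 * e6 ^+ 7) = e2 * e4 ^+ 2 * e12 ^+ 2 * e3 ^+ 3.
Proof.
apply: reg2.
transitivity (y * (e2 * e6 ^+ 5) * e6 ^+ 2 * e1 + s * e6 ^+ 7 * e1 * e2); first by ring.
rewrite Ey Es; transitivity (e4 * e12 *
  (e1 * (e4 ^+ 4 * e6 ^+ 2 + q * e2 ^+ 2 * e12 ^+ 4))); first by ring.
by rewrite -dissection; ring.
Qed.

Hypothesis Exx : x * (x - 1) * e3 ^+ 14 = q * (e1 * e2 * e6 ^+ 5) ^+ 2.
Hypothesis Ess : s ^+ 2 = y ^+ 2 - y.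

Lemma x_dissection : x = 5 * y - 4 * y ^+ 2 + s * (4 * y - 3).
Proof.
(* The eta quotient for x (x - 1), divided by the one for x. *)
have Ex1 : (x - 1) * (e2 ^+ 3 * e3 ^+ 9) = q * e1 ^+ 3 * e6 ^+ 9.
  apply: (lregM (lregX (n := 2) reg2) reg6).
  transitivity ((x - 1) * e3 ^+ 9 * (e2 ^+ 5 * e6)); first by ring.
  rewrite -Ex; transitivity (x * (x - 1) * e3 ^+ 14 * e1); first by ring.
  by rewrite Exx; ring.
have Exy : (x - 1) * (y + s) ^+ 3 = s * y.
  apply: (lregM (lregM (lregX (n := 3) reg2) (lregX (n := 9) reg3))
                (lregX (n := 3) (lregM reg1 (lregX (n := 7) reg6)))).
  transitivity ((x - 1) * (e2 ^+ 3 * e3 ^+ 9) * ((y + s) * (e1 * e6 ^+ 7)) ^+ 3).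
    by ring.
  rewrite Ex1 y_add_s; transitivity (q * e2 * e4 * e12 ^+ 5 * (e4 ^+ 5 * e12) *
    (e2 ^+ 2 * e3 ^+ 9 * e1 ^+ 3 * e6 ^+ 9)); first by ring.
  by rewrite -Ey -Es; ring.
(* Multiplying [Exy] by (y - s)^3 thus gives y^3 (x - 1) = s y (y - s)^3; reducing s^2 and
   cancelling y^3 leaves the claim. *)
have norm : (y + s) * (y - s) = y by transitivity (y ^+ 2 - s ^+ 2); [ring | rewrite Ess; ring].
apply/eqP; rewrite -subr_eq0; apply/eqP; apply: (lregX (n := 3) regy); rewrite mulr0.
transitivity (y ^+ 3 * (x - 1) - y ^+ 3 * (5 * y - 4 * y ^+ 2 + s * (4 * y - 3) - 1)).
  by ring.
have -> : y ^+ 3 * (x - 1) = s * y * (y - s) ^+ 3.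
  by rewrite -Exy -{1}norm; ring.
by ring: Ess.
Qed.

End EtaAlgebra.

(** * The substitution of q^2 for q *)

Definition dil2 (f : fps) : fps := ps_dil 2 f.

Lemma coef_dil2 f n : dil2 f (2 * n)%N = f n.
Proof. by rewrite /dil2 /ps_dil dvdn_mulr // mulKn. Qed.

Lemma dil2_inj : injective dil2.
Proof. by move=> f g eqfg; apply: fpsP => n; rewrite -(coef_dil2 f) -(coef_dil2 g) eqfg. Qed.

Lemma dil2_trunc N f : eqm N (dil2 f) (ps_poly (ptrunc N f \Po 'X^2)).
Proof.
move=> n ltnN; rewrite /ps_poly coef_comp_poly_Xn // /dil2 /ps_dil; case: ifP => // _.
by rewrite coef_poly (leq_ltn_trans (leq_div _ _) ltnN).
Qed.

Fact dil2_is_zmod_morphism : zmod_morphism dil2.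
Proof.
move=> f g; apply: fpsP => n.
by rewrite coefpsD coefpsN /dil2 /ps_dil; case: ifP => _; rewrite ?subr0.
Qed.

Fact dil2_is_monoid_morphism : monoid_morphism dil2.
Proof.
split=> [|f g]; apply: fpsP => n.
  rewrite /dil2 /ps_dil !coefps1; case: ifP => d2; first by congr (_%:R); lia.
  by case: eqP => // n0; rewrite n0 in d2.
rewrite (eqmM (dil2_trunc f) (dil2_trunc g) (ltnSn n)) -rmorphM -rmorphM /=.
rewrite /ps_poly coef_comp_poly_Xn // /dil2 /ps_dil; case: ifP => // _.
by apply: ps_mul_trunc; rewrite ltnS leq_div.
Qed.

HB.instance Definition _ :=
  GRing.isZmodMorphism.Build fps fps dil2 dil2_is_zmod_morphism.
HB.instance Definition _ :=
  GRing.isMonoidMorphism.Build fps fps dil2 dil2_is_monoid_morphism.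

Lemma dil2_etaq k : (0 < k)%N -> dil2 (etaq k) = etaq (k * 2).
Proof.
move=> k0; apply: fpsP => n; rewrite /dil2 /etaq /Eq /ps_dil mulnC divnMA.
case: (boolP (2 %| n)%N) => [d2|nd2]; first by rewrite dvdn_divRL // mulnC.
by case: ifP => // /(dvdn_trans (dvdn_mulr k (dvdnn 2))); rewrite (negPf nd2).
Qed.

Lemma dil2_psX : dil2 psX = psX ^+ 2.
Proof.
apply: fpsP => n; rewrite coefpsXn /dil2 /ps_dil -[psX]expr1 coefpsXn.
by case: ifP => d2; lia.
Qed.

(** * The dissections of xi and kappa *)

Definition xi : fps := xi_ps.
Definition kappa : fps := kappa_ps.
Definition gamma : fps := gamma_ps.

Lemma ps_zpowN (f : fps) k : f 0%N = 1 -> f ^+ k.+1 * (ps_zpow f (- k.+1%:Z) : fps) = 1.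
Proof.
move=> f0; rewrite -NegzE -ps_powE; apply: ps_mulV.
by rewrite ps_powE coef0_exp.
Qed.

Lemma gammaE : gamma * etaq 3 ^+ 15 = (etaq 1 * etaq 2 * etaq 6) ^+ 5.
Proof.
have := ps_zpowN 14 (coef0_etaq (isT : 0 < 3)%N).
rewrite /gamma /gamma_ps !ps_powE -/(etaq 1) -/(etaq 2) -/(etaq 6) -/(etaq 3).
set z : fps := ps_zpow _ _ => Ez.
transitivity ((etaq 1 * etaq 2 * etaq 6) ^+ 5 * (etaq 3 ^+ 15 * z)); last by rewrite Ez mulr1.
by rewrite !exprMn mulrA [RHS]mulrAC.
Qed.

Lemma xiE : xi * (etaq 1 * etaq 3 ^+ 5) = etaq 2 ^+ 5 * etaq 6.
Proof.
have := ps_zpowN 4 (coef0_etaq (isT : 0 < 3)%N).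
have := ps_zpowN 0 (coef0_etaq (isT : 0 < 1)%N).
rewrite /xi /xi_ps !ps_powE -/(etaq 1) -/(etaq 2) -/(etaq 6) -/(etaq 3).
set z1 : fps := ps_zpow _ _; set z3 : fps := ps_zpow _ _ => E1 E3.
transitivity (etaq 2 ^+ 5 * etaq 6 * (etaq 1 ^+ 1 * z1) * (etaq 3 ^+ 5 * z3)); last first.
  by rewrite E1 E3 !mulr1.
rewrite -[LHS]/(etaq 2 ^+ 5 * etaq 6 * z1 * z3 * (etaq 1 * etaq 3 ^+ 5)).
by ring.
Qed.

Lemma coef0_gamma : gamma 0%N = 1.
Proof.
have := congr1 (@^~ 0%N) gammaE.
by rewrite !(coef0_mul, coef0_exp) ?coef0_etaq // mulr1.
Qed.

Lemma kappaE : kappa * gamma = dil2 gamma ^+ 2.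
Proof.
have := ps_zpowN 0 coef0_gamma; rewrite /kappa /kappa_ps ps_powE -/gamma.
set z : fps := ps_zpow _ _ => E.
rewrite -[LHS]/(dil2 gamma ^+ 2 * z * gamma).
by rewrite -mulrA [z * _]mulrC -[gamma]expr1 E mulr1.
Qed.

Lemma coef0_xi : xi 0%N = 1.
Proof.
have := congr1 (@^~ 0%N) xiE.
by rewrite !(coef0_mul, coef0_exp) ?coef0_etaq // !mulr1.
Qed.

(* [s_ps = q w_ps(q^2)] is the odd part of the fifth root of [kappa], whose even
   part is [xi(q^2)]. *)
Definition w_ps : fps :=
  etaq 1 * etaq 2 * etaq 6 ^+ 5 * (ps_inv (etaq 3 ^+ 7) : fps).

Definition s_ps : fps := psX * dil2 w_ps.

Lemma theta_51_33 e : e * e = 1 ->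
  theta 5 1 e * theta 3 3 (- e) =
  etaq 4 * etaq 4 + e * psX * (theta 10 2 (-1) * theta 10 2 (-1)).
Proof. by move=> ee; rewrite schroeter // (theta_pentagonal (m := 4)). Qed.

Lemma etaq_dissection :
  etaq 3 ^+ 3 * etaq 2 ^+ 2 * etaq 12 * etaq 4 =
    etaq 1 * (etaq 4 ^+ 4 * etaq 6 ^+ 2 + psX * etaq 2 ^+ 2 * etaq 12 ^+ 4) /\
  (etaq 4 ^+ 8 * etaq 6 ^+ 4 - psX ^+ 2 * etaq 2 ^+ 4 * etaq 12 ^+ 8) * etaq 12 =
    etaq 2 * etaq 4 ^+ 3 * etaq 6 ^+ 9.
Proof.
have reg := lreg_etaq.
(* The signs e = 1 and e = -1 give the formula at q and at -q. *)
have Sp := theta_51_33 (mulr1 1).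
have Sm := theta_51_33 mulN1N1.
rewrite mul1r in Sp; rewrite opprK mulN1r mulNr in Sm.
apply: (dissection_identities (reg 6 isT) (reg 12 isT) Sp Sm).
- exact: (theta_5_1 (m := 1)).
- exact: (theta_5_1 (m := 2)).
- exact: (theta_conj (c := 5) (d := 1) isT isT (mulr1 1)).
- exact: (theta_diag (m := 3)).
- exact: (theta_diag (m := 6)).
- exact: (theta_conj (c := 3) (d := 3) isT isT (mulr1 1)).
Qed.

(** The second identity of [etaq_dissection] involves only q^2, so it is the image of this one under
    the injective [dil2]. *)
Lemma level6_norm :
  (etaq 2 ^+ 8 * etaq 3 ^+ 4 - psX * etaq 1 ^+ 4 * etaq 6 ^+ 8) * etaq 6 =
  etaq 1 * etaq 2 ^+ 3 * etaq 3 ^+ 9.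
Proof.
apply: dil2_inj; rewrite !(rmorphXn, rmorphM, rmorphB) /= dil2_psX !dil2_etaq //.
by case: etaq_dissection.
Qed.

Lemma w_psE : w_ps * etaq 3 ^+ 7 = etaq 1 * etaq 2 * etaq 6 ^+ 5.
Proof.
rewrite /w_ps -mulrA [X in _ * X]mulrC ps_mulV ?mulr1 //.
by rewrite coef0_exp // coef0_etaq.
Qed.

Lemma xi_quadratic : psX * w_ps ^+ 2 = xi ^+ 2 - xi.
Proof.
have reg := lreg_etaq.
apply: (lregX (n := 14) (reg 3 isT)).
transitivity (xi * (xi - 1) * etaq 3 ^+ 14); last by ring.
rewrite (level6_relation (reg 1%N isT) xiE level6_norm) -w_psE; ring.
Qed.

Lemma s_ps_sq : s_ps ^+ 2 = dil2 xi ^+ 2 - dil2 xi.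
Proof.
have := congr1 dil2 xi_quadratic.
by rewrite rmorphB rmorphM !rmorphXn /= dil2_psX /s_ps exprMn.
Qed.

Lemma s_psE : s_ps * etaq 6 ^+ 7 = psX * etaq 2 * etaq 4 * etaq 12 ^+ 5.
Proof.
rewrite /s_ps; move: (w_ps) w_psE => w /(congr1 dil2).
rewrite !(rmorphXn, rmorphM) /= !dil2_etaq // => E.
by rewrite -mulrA E !mulrA.
Qed.

Lemma dil2_xiE : dil2 xi * (etaq 2 * etaq 6 ^+ 5) = etaq 4 ^+ 5 * etaq 12.
Proof.
move: (xi) xiE => x /(congr1 dil2).
by rewrite !(rmorphXn, rmorphM) /= !dil2_etaq.
Qed.

Lemma xi_dissection :
  xi = 5 * dil2 xi - 4 * dil2 xi ^+ 2 + s_ps * (4 * dil2 xi - 3).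
Proof.
have reg := lreg_etaq.
have regy : GRing.lreg (dil2 xi).
  by apply: lreg_coef0; rewrite -[0%N]/(2 * 0)%N coef_dil2 coef0_xi.
apply: (x_dissection (reg 1%N isT) (reg 2 isT) (reg 3 isT) (reg 6 isT) regy
  (proj1 etaq_dissection) dil2_xiE xiE s_psE _ s_ps_sq).
exact: (level6_relation (reg 1%N isT) xiE level6_norm).
Qed.

(** In gamma(q^2)^2 / gamma(q) every exponent is a multiple of 5, and the fifth root is the eta
    quotient of [y_add_s]. *)
Lemma kappa_dissection : kappa = (dil2 xi + s_ps) ^+ 5.
Proof.
have reg := lreg_etaq.
have Ez := y_add_s (reg 2 isT) (proj1 etaq_dissection) dil2_xiE s_psE.
have Edg : dil2 gamma * etaq 6 ^+ 15 = (etaq 2 * etaq 4 * etaq 12) ^+ 5.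
  move: (gamma) gammaE => w /(congr1 dil2).
  by rewrite !(rmorphXn, rmorphM) /= !dil2_etaq.
apply: (lregM (lregM (lreg_coef0 coef0_gamma) (lregX (n := 15) (reg 3 isT)))
   (lregX (n := 30) (reg 6 isT))).
transitivity (kappa * gamma * etaq 3 ^+ 15 * etaq 6 ^+ 30); first by ring.
rewrite kappaE; transitivity ((dil2 gamma * etaq 6 ^+ 15) ^+ 2 * etaq 3 ^+ 15); first by ring.
rewrite Edg; move: Ez; set z := dil2 xi + s_ps => Ez.
transitivity ((z * (etaq 1 * etaq 6 ^+ 7)) ^+ 5 * etaq 2 ^+ 5); first by rewrite Ez; ring.
transitivity (z ^+ 5 * (gamma * etaq 3 ^+ 15) * etaq 6 ^+ 30); first by rewrite gammaE; ring.
by ring.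
Qed.

(** * The ring Z[y] + s Z[y] and the operator U *)

Lemma coefpsMz f (m : int) n : (f *~ m) n = m * f n.
Proof.
have coefMn k : (f *+ k) n = k%:Z * f n.
  by elim: k => [|k IHk]; rewrite ?mul0r // mulrS coefpsD IHk intS mulrDl mul1r.
by case: m => k; rewrite ?NegzE ?mulrNz ?coefpsN -?pmulrn coefMn ?mulNr.
Qed.

Section EvenOddSpan.
Variables x s : fps.
Hypothesis Ess : s ^+ 2 = dil2 x ^+ 2 - dil2 x.

Definition ps_eval (p : {poly int}) : fps := (map_poly intr p).[x].

Definition dil2_span f := exists p r, f = dil2 (ps_eval p) + s * dil2 (ps_eval r).

Lemma dil2_spanM f g : dil2_span f -> dil2_span g -> dil2_span (f * g).
Proof.
move=> [p [r ->]] [p' [r' ->]].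
(* The term s^2 r r' joins the even part through s^2 = y^2 - y, with y = [dil2 x]. *)
exists (p * p' + ('X ^+ 2 - 'X) * r * r'), (p * r' + r * p').
rewrite /ps_eval !(rmorphXn, rmorphD, rmorphM, rmorphN) /= map_polyX.
rewrite !hornerE !(rmorphXn, rmorphD, rmorphM, rmorphN) /=.
by ring: Ess.
Qed.

Lemma dil2_spanX f k : dil2_span f -> dil2_span (f ^+ k).
Proof.
move=> spf; elim: k => [|k IHk]; last by rewrite exprS; apply: dil2_spanM.
exists 1, 0; rewrite /ps_eval rmorph0 rmorph1 horner0 hornerE rmorph0 rmorph1.
by rewrite mulr0 addr0.
Qed.

Lemma dil2_span_kappa : dil2_span ((dil2 x + s) ^+ 5).
Proof.
apply: dil2_spanX; exists 'X, 1.
by rewrite /ps_eval map_polyX rmorph1 !hornerE rmorph1 mulr1.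
Qed.

Lemma dil2_span_xi :
  dil2_span (5 * dil2 x - 4 * dil2 x ^+ 2 + s * (4 * dil2 x - 3)).
Proof.
exists (5 * 'X - 4 * 'X^2), (4 * 'X - 3).
rewrite /ps_eval !(rmorphXn, rmorph_nat, rmorphD, rmorphM, rmorphN) /= map_polyX.
by rewrite !hornerE !(rmorph_nat, rmorphXn, rmorphD, rmorphM, rmorphN) /=; ring.
Qed.

Lemma ps_evalE p : ps_eval p =1 ps_poly_eval p x.
Proof.
move=> n; rewrite /ps_eval (@horner_coef_wide _ (size p)) ?size_poly // coefps_sum.
by apply: eq_bigr => k _; rewrite coef_map /= ps_powE mulrzl coefpsMz.
Qed.

End EvenOddSpan.

(** The second summand is q times a series in q^2, so it has only odd exponents and [U] discards it;
    on the first, [U] undoes [dil2]. *)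
Lemma U_even_odd f g h : U (dil2 f + psX * dil2 g * dil2 h) =1 f.
Proof.
move=> n; rewrite /U coefpsD coef_dil2 -mulrA -rmorphM -[psX]expr1 coefpsXnM.
case: ifP => [_|n1]; first by rewrite addr0.
rewrite /= /dil2 /ps_dil ifN ?addr0 //; lia.
Qed.

Theorem theorem2p2 (i j : nat) :
  exists p : {poly int},
    U (ps_mul (ps_pow kappa_ps i) (ps_pow xi_ps j)) =1 ps_poly_eval p xi_ps.
Proof.
have spk := dil2_span_kappa s_ps_sq; rewrite -kappa_dissection in spk.
have spx := dil2_span_xi xi s_ps; rewrite -xi_dissection in spx.
have [p [r E]] := dil2_spanM s_ps_sq (dil2_spanX s_ps_sq i spk) (dil2_spanX s_ps_sq j spx).
exists p => n; rewrite -[RHS](ps_evalE xi) !ps_powE.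
(* As [s_ps] is q w(q^2), the product has the shape of [U_even_odd] with even part p(xi(q^2)). *)
by rewrite -[RHS](U_even_odd _ w_ps (ps_eval xi r)) -[psX * dil2 w_ps]/s_ps -E.
Qed.
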